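(* Let $G$ be a finite connected graph with two distinct marked vertices $X_0$ and $Y_0$. Let $X_i$ be a simple random walk on $G$ started at $X_0$ and stopped when hitting $Y_0$, and let $\mathrm{PATH}$ be the subgraph of $G$ consisting of all the edges the random walk crossed before being stopped at $Y_0$. For a vertex $x$ let $v(x)$ be the probability that a simple random walk on $G$ started at $x$ hits $X_0$ before $Y_0$. Let $s=\max\{v(y): y\sim Y_0\}$ and $d=\max\{\deg(x): x\ne Y_0\}$. Then $$E\bigl(R_{\mathrm{eff}}(X_0\leftrightarrow Y_0;\mathrm{PATH})\bigr)\ge\frac{\log(1/s)}{12\log(d)}.$$
   Context: $R_{\mathrm{eff}}(v\leftrightarrow u;H)$ denotes the effective resistance between $v$ and $u$ in the network $H$ (the reciprocal of the effective conductance); in $\mathrm{PATH}$ every edge is a unit resistor. $y\sim Y_0$ means $y$ is adjacent to $Y_0$. When $s=1$ (i.e. $X_0\sim Y_0$) the right-hand side is interpreted as $0$. *)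

(* Defs.v *)
(* MathComp / MathComp-Analysis. *)
From HB Require Import structures.
From mathcomp Require Export all_boot all_order all_algebra.
From mathcomp Require Export all_classical all_reals all_analysis.

Set Implicit Arguments.
Unset Strict Implicit.
Unset Printing Implicit Defensive.

Import Order.TTheory GRing.Theory Num.Theory.
Import numFieldNormedType.Exports.

Local Open Scope classical_set_scope.
Local Open Scope ring_scope.

(* A finite simple graph is a symmetric irreflexive boolean relation on a
   finType; a subgraph is given by its own (smaller) adjacency relation. *)
Section Graph.
Variables (V : finType) (e : rel V).

Definition deg (x : V) : nat := #|[pred y | e x y]|.

Definition connected_graph : Prop := forall x y : V, connect e x y.

End Graph.

Section Network.
Variables (R : realType) (V : finType) (H : rel V).

(* [f] is a voltage of the unit-resistor network [H] with [a] held at 1 and [b]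
   held at 0: Kirchhoff's node law holds at every other vertex. *)
Definition unit_voltage (a b : V) (f : V -> R) : Prop :=
  [/\ f a = 1, f b = 0 &
      forall x, x != a -> x != b -> \sum_(y | H x y) (f x - f y) = 0].

(* The current out of [a] is the same for all unit voltages: they can differ
   only on components of [H] containing neither [a] nor [b]. *)
Definition eff_conductance (a b : V) : R :=
  xget 0 [set c | exists2 f, unit_voltage a b f & c = \sum_(y | H a y) (f a - f y)].

(* On extended reals 0^-1 = +oo, the value when [H] does not connect [a] to [b]. *)
Definition eff_resistance (a b : V) : \bar R :=
  ((eff_conductance a b)%:E^-1)%E.

End Network.

Section Walk.
Variables (R : realType) (V : finType) (e : rel V).
Variables (disp : measure_display) (Omega : measurableType disp).

Definition step_prob (x y : V) : R := if e x y then (deg e x)%:R^-1 else 0.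

(* Under [P], [X] is simple random walk on [e] started at [x]: given any past
   [p 0, ..., p n], the next position is a uniform neighbour of [p n]. *)
Definition is_srw (P : probability Omega R) (X : nat -> Omega -> V) (x : V) : Prop :=
  [/\ forall n y, measurable [set w | X n w = y],
      P [set w | X 0%N w = x] = 1%E &
      forall (n : nat) (p : nat -> V),
        P [set w | forall i, (i <= n.+1)%N -> X i w = p i] =
        (P [set w | forall i, (i <= n)%N -> X i w = p i] *
         (step_prob (p n) (p n.+1))%:E)%E].

Definition hits_before (X : nat -> Omega -> V) (a b : V) : set Omega :=
  [set w | exists n, X n w = a /\ forall m, (m <= n)%N -> X m w <> b].

(* [P x] is the law under which [X] starts at [x]. *)
Definition hit_prob (P : V -> probability Omega R) (X : nat -> Omega -> V)
    (a b : V) (x : V) : R :=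
  fine (P x (hits_before X a b)).

(* The edges of [e] crossed before the walk is stopped at [b]: step [n] is taken
   when [b] has not been visited up to time [n], so the last step, into [b], is
   included. *)
Definition walk_path (X : nat -> Omega -> V) (b : V) (w : Omega) : rel V :=
  fun x y => e x y &&
    `[< exists n, (forall m, (m <= n)%N -> X m w <> b) /\
          ((X n w = x /\ X n.+1 w = y) \/ (X n w = y /\ X n.+1 w = x)) >].

End Walk.

(* Main.v *)
Require Import Defs.
From mathcomp Require Import ring lra measurable_realfun.
Import Order.TTheory GRing.Theory Num.Theory.
Import numFieldNormedType.Exports.
Local Open Scope classical_set_scope.
Local Open Scope ring_scope.

(** The hitting probability [v] is the voltage on the graph with [X0] held at 1
    and [Y0] held at 0. Let [C > 0] be the current it drives.

    Reversibility makes the expected number of visits to [x] before [Y0],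
    divided by [deg x], the potential of a unit current, namely [v x / C]. So a
    given edge [xy] is crossed with probability at most [(v x + v y) / C]
    ([probability_walk_path_le]). Edges of low voltage are therefore rare in
    PATH, and a test function for the Dirichlet principle on PATH can afford to
    vary there. The right scale is logarithmic: take [phi = ln (max v s)]. It
    drops by [L = ln (1/s)] from [X0] to [Y0], and it is constant on the edges
    at [Y0], where the ratio of voltages may be infinite. Across any other edge the
    ratio of the voltages is at most [d] by harmonicity
    ([voltage_harnack]), whence, with [K = 12 ln d], by [ln_max_slope],
      [(v x + v y) (phi x - phi y)^2 <= K (v x - v y) (phi x - phi y)].

    Summed over the edges, the right-hand side is [K C L] by Green's identity
    ([voltage_energy]). Hence the expected energy of [phi] on PATH is at most
    [K L]. The conductance of PATH is at most that energy divided by [L^2]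
    ([eff_conductance_le_energy]), and Jensen's inequality bounds the expected
    resistance below by [L^2 / (K L) = L / K] ([expected_resistance_ge]). *)

Set Implicit Arguments.
Unset Strict Implicit.
Unset Printing Implicit Defensive.

(** * Energy of functions on a network *)

Section Degree.
Variables (R : realType) (V : finType) (e : rel V).

Lemma deg_mulr x (c : R) : \sum_(y | e x y) c = (deg e x)%:R * c.
Proof. by rewrite sumr_const mulr_natl. Qed.

Lemma deg_gt0 x y : e x y -> (0 < deg e x)%N.
Proof. by move=> exy; apply/card_gt0P; exists y. Qed.

End Degree.

Section Energy.
Variables (R : realType) (V : finType) (H : rel V).

(** The factor 1/2 compensates for each edge being seen in both directions. *)
Definition energy (f g : V -> R) : R :=
  2^-1 * \sum_x \sum_(y | H x y) (f x - f y) * (g x - g y).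

Lemma energy_sqr_ge0 (f : V -> R) : 0 <= energy f f.
Proof.
rewrite mulr_ge0 ?invr_ge0 ?ler0n//.
by apply: sumr_ge0 => x _; apply: sumr_ge0 => y _; rewrite -expr2 sqr_ge0.
Qed.

Hypothesis H_sym : symmetric H.

Lemma sum_edge_swap (F : V -> V -> R) :
  \sum_x \sum_(y | H x y) F x y = \sum_x \sum_(y | H x y) F y x.
Proof.
under eq_bigr do rewrite big_mkcond.
rewrite exchange_big; apply: eq_bigr => x _.
by rewrite [RHS]big_mkcond; apply: eq_bigr => y _; rewrite H_sym.
Qed.

Lemma greens_identity (f g : V -> R) :
  energy f g = \sum_x g x * \sum_(y | H x y) (f x - f y).
Proof.
have E : \sum_x \sum_(y | H x y) (f x - f y) * (g x - g y) =
    2 * \sum_x g x * \sum_(y | H x y) (f x - f y).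
  transitivity (\sum_x \sum_(y | H x y) (f x - f y) * g x +
                \sum_x \sum_(y | H x y) (f y - f x) * g y).
    rewrite -big_split; apply: eq_bigr => x _; rewrite -big_split.
    by apply: eq_bigr => y _ /=; ring.
  have /= <- := sum_edge_swap (fun x y => (f x - f y) * g x).
  rewrite -mulr2n -[LHS]mulr_natl.
  congr (_ * _); apply: eq_bigr => x _; rewrite mulr_sumr.
  by apply: eq_bigr => y _; rewrite mulrC.
by rewrite /energy E mulrA mulVf ?mul1r// pnatr_eq0.
Qed.

Lemma voltage_energy (a b : V) (f g : V -> R) : a != b ->
  unit_voltage H a b f ->
  energy f g = (\sum_(y | H a y) (f a - f y)) * (g a - g b).
Proof.
move=> ab [fa fb fK].
have sumE (u : V -> R) : \sum_x u x * \sum_(y | H x y) (f x - f y) =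
    u a * \sum_(y | H a y) (f a - f y) + u b * \sum_(y | H b y) (f b - f y).
  rewrite (bigD1 a)// (bigD1 b) 1?eq_sym//= addrA [X in _ + X]big1 ?addr0//.
  by move=> x /andP[xa xb]; rewrite fK// mulr0.
(* The net currents out of all vertices sum to zero, so the current into [b] is
   the current out of [a]. *)
have Hb : \sum_(y | H b y) (f b - f y) = - \sum_(y | H a y) (f a - f y).
  have := greens_identity f (fun=> 1); rewrite sumE !mul1r.
  have -> : energy f (fun=> 1) = 0.
    rewrite /energy big1 ?mulr0// => x _; rewrite big1// => y _.
    by rewrite subrr mulr0.
  by move=> /eqP; rewrite eq_sym addrC addr_eq0 => /eqP.
by rewrite greens_identity sumE Hb; ring.
Qed.

Lemma eff_conductance_ge0 (a b : V) : a != b -> 0 <= eff_conductance R H a b.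
Proof.
move=> ab; rewrite /eff_conductance; case: xgetP => [c _ [f vf ->]|//].
have [fa fb _] := vf.
have := voltage_energy f ab vf; rewrite fa fb subr0 mulr1 => <-.
exact: energy_sqr_ge0.
Qed.

(** The Dirichlet principle: a voltage [f] and a function [g] with
    [l = g a - g b] satisfy [energy f g = l * energy f f], so [g] has at least
    the energy of [l f]. If there is no voltage, the conductance has the default
    value 0 and the bound holds trivially. *)
Lemma eff_conductance_le_energy (a b : V) (g : V -> R) : a != b ->
  eff_conductance R H a b * (g a - g b) ^+ 2 <= energy g g.
Proof.
move=> ab; rewrite /eff_conductance; case: xgetP => [c _ [f vf ->]|_]; last first.
  by rewrite mul0r energy_sqr_ge0.
have [fa fb _] := vf.
have Eff := voltage_energy f ab vf; rewrite fa fb subr0 mulr1 in Eff.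
have Efg := voltage_energy g ab vf; rewrite fa in Efg.
rewrite fa; set l := g a - g b in Efg *; rewrite -Eff in Efg *.
(* Expand the nonnegative energy of [g - l f]. *)
have := energy_sqr_ge0 (fun x => g x - l * f x).
have -> : energy (fun x => g x - l * f x) (fun x => g x - l * f x) =
    energy g g - 2 * l * energy f g + l ^+ 2 * energy f f.
  rewrite /energy !(mulrCA _ 2^-1) -mulrBr -mulrDr; congr (_ * _).
  rewrite !mulr_sumr -sumrB -big_split; apply: eq_bigr => x _ /=.
  rewrite !mulr_sumr -sumrB -big_split; apply: eq_bigr => y _ /=.
  by ring.
by rewrite Efg; lra.
Qed.

(** Combine [c l^2 <= energy] with [1/c + t^2 c l^2 >= 2 t l], where [c] is the
    conductance and [l = g a - g b]. The resulting lower bound on the resistance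
    is affine in the energy, so it can be integrated over random networks. *)
Lemma eff_resistance_ge_affine (a b : V) (g : V -> R) (t : R) : a != b ->
  ((2 * t * (g a - g b))%:E <=
   eff_resistance R H a b + (t ^+ 2 * energy g g)%:E)%E.
Proof.
move=> ab; have := eff_conductance_le_energy g ab; have := eff_conductance_ge0 ab.
rewrite /eff_resistance inver; set c := eff_conductance _ _ _ _; set l := g a - g b.
case: eqP => [_ _ _|/eqP c_neq0 c_ge0 cE].
  by rewrite addye ?leey// gt_eqF ?ltNyr.
have c_gt0 : 0 < c by rewrite lt_neqAle eq_sym c_neq0.
rewrite -EFinD lee_fin.
have tcE : t ^+ 2 * (c * l ^+ 2) <= t ^+ 2 * energy g g.
  by rewrite ler_wpM2l ?sqr_ge0.
have : 0 <= c^-1 * (1 - t * c * l) ^+ 2 by rewrite mulr_ge0 ?invr_ge0 ?sqr_ge0.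
have -> : c^-1 * (1 - t * c * l) ^+ 2 = c^-1 + t ^+ 2 * (c * l ^+ 2) - 2 * t * l.
  by field.
lra.
Qed.

(** The voltage at [y] is the mean over its neighbours, hence at least the share
    [f x / deg y] of any single one of them. At the source this is [f <= 1]. *)
Lemma voltage_harnack (a b x y : V) (f : V -> R) : unit_voltage H a b f ->
  (forall z, 0 <= f z <= 1) -> H x y -> y != b -> f x <= (deg H y)%:R * f y.
Proof.
move=> [fa fb fK] f01 Hxy yb; have [f0 f1] : (forall z, 0 <= f z) /\ (forall z, f z <= 1).
  by split=> z; case/andP: (f01 z).
have Hyx : H y x by rewrite H_sym.
have [ya|ya] := eqVneq y a.
  rewrite ya fa mulr1; apply: le_trans (f1 x) _.
  by rewrite ler1n -ya (deg_gt0 Hyx).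
have /eqP := fK y ya yb; rewrite sumrB deg_mulr subr_eq0 => /eqP ->.
by rewrite (bigD1 x)//= lerDl sumr_ge0.
Qed.

(** For a connected network the current is positive: the energy of the voltage
    vanishes only if the voltage is constant. *)
Lemma voltage_current_gt0 (a b : V) (f : V -> R) : a != b ->
  connected_graph H -> unit_voltage H a b f -> 0 < \sum_(y | H a y) (f a - f y).
Proof.
move=> ab Hc vf; have [fa fb _] := vf.
have Eff := voltage_energy f ab vf; rewrite fa fb subr0 mulr1 in Eff.
rewrite fa -Eff lt_neqAle energy_sqr_ge0 andbT; apply/negP => /eqP E0.
have fE x y : H x y -> f x = f y.
  move=> Hxy; apply/eqP; rewrite -subr_eq0 -sqrf_eq0.
  move/esym/eqP: E0; rewrite mulf_eq0 invr_eq0 pnatr_eq0 /=.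
  have ge0 z t : 0 <= (f z - f t) * (f z - f t) by rewrite -expr2 sqr_ge0.
  rewrite psumr_eq0 => [/allP /(_ x)|z _]; last exact: sumr_ge0.
  rewrite mem_index_enum => /(_ isT) /=.
  rewrite psumr_eq0// => /allP /(_ y).
  by rewrite mem_index_enum Hxy -expr2 => /(_ isT).
have /connectP[p] := Hc a b.
suff : forall x, path H x p -> f (last x p) = f x.
  move=> S /S + bE; rewrite -bE fa fb => /eqP.
  by rewrite eq_sym oner_eq0.
by elim: p => //= y p IH x /andP[/fE -> /IH].
Qed.

End Energy.

(** * The logarithm of the voltage across an edge *)

(** The quotient [(r + 1) ln r / (r - 1)] stays bounded near 1 and grows like
    [ln r]. From 2 on, [(r + 1) / (r - 1) <= 3]; below 2, [ln r <= r - 1] leaves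
    [r + 1 <= 3 <= 12 ln d]. The constant 12 is not sharp. *)
Lemma ln_slope (R : realType) (d r : R) : 2 <= d -> 1 <= r <= d ->
  (r + 1) * ln r <= 12 * ln d * (r - 1).
Proof.
move=> d2 /andP[r1 rd].
have r0 : 0 < r by lra.
have lnr : 0 <= ln r by rewrite ln_ge0.
have lnrd : ln r <= ln d by rewrite ler_ln// posrE; lra.
have [r2|r2] := leP 2 r; first by nra.
have le_lnB1 (x : R) : 0 < x -> ln x <= x - 1.
  by move=> x0; have := @le_ln1Dx R (x - 1); rewrite (addrC 1) subrK; apply; lra.
have ln2 : 2^-1 <= ln d.
  have := le_lnB1 2^-1 ltac:(lra).
  rewrite lnV ?posrE//= => h.
  have : ln 2 <= ln d by rewrite ler_ln// posrE; lra.
  lra.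
have := le_lnB1 r r0; nra.
Qed.

(** The weight [p + q] bounds the probability that an edge with voltages [p] and
    [q] is crossed, up to the factor [1 / C]. Capping the voltages from below by
    [s] can only decrease the difference of the logarithms, so [ln_slope] at
    [p / q] is enough. *)
Lemma ln_max_slope (R : realType) (s d p q : R) : 0 < s -> 2 <= d ->
  0 <= p -> 0 <= q -> p <= d * q -> q <= d * p ->
  (p + q) * (ln (Num.max p s) - ln (Num.max q s)) ^+ 2 <=
  12 * ln d * ((p - q) * (ln (Num.max p s) - ln (Num.max q s))).
Proof.
move=> s0 d2; wlog qp : p q / q <= p => [W p0 q0 pq qp|p0 q0 pq _].
  have [/W/(_ p0 q0 pq qp)//|/ltW /W/(_ q0 p0 qp pq)] := leP q p.
  by rewrite [q + p]addrC; lra.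
have [qE|q_neq0] := eqVneq q 0.
  have -> : p = q by apply/le_anti; rewrite qp andbT; move: pq; rewrite qE mulr0.
  by rewrite !subrr expr2 !mulr0.
have q_gt0 : 0 < q by rewrite lt_neqAle eq_sym q_neq0.
have p_gt0 : 0 < p by exact: lt_le_trans qp.
have slope : (p + q) * (ln p - ln q) <= 12 * ln d * (p - q).
  have -> : (p + q) * (ln p - ln q) = q * ((p / q + 1) * (ln p - ln q)) by field.
  have -> : 12 * ln d * (p - q) = q * (12 * ln d * (p / q - 1)) by field.
  rewrite ler_pM2l// -ln_div ?posrE//; apply: ln_slope => //.
  by rewrite ler_pdivlMr// mul1r qp ler_pdivrMr.
set D := ln (Num.max p s) - ln (Num.max q s).
have max0 r : 0 < Num.max r s by rewrite lt_max s0 orbT.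
have D0 : 0 <= D by rewrite subr_ge0 ler_ln ?posrE// le_max2.
have Dle : D <= ln p - ln q.
  rewrite /D /Num.max; case: (ltP p s) => ps; case: (ltP q s) => qs.
  - by rewrite subrr subr_ge0 ler_ln.
  - by have := le_lt_trans qp ps; lra.
  - by rewrite lerB// ler_ln// ltW.
  - by [].
have DE : (p + q) * D <= 12 * ln d * (p - q).
  by apply: le_trans slope; rewrite ler_wpM2l// addr_ge0.
by rewrite expr2 !mulrA ler_wpM2r.
Qed.

(** * The law of the walk *)

Section Discrete.
Variables (disp : measure_display) (Omega : measurableType disp).

Lemma measurable_discrete (T : countType) (f : Omega -> T) (A : set T) :
  (forall t, measurable [set w | f w = t]) -> measurable (f @^-1` A).
Proof.
move=> mf.
have -> : f @^-1` A = \bigcup_t ([set w | f w = t] `&` [set w | A t]).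
  apply/seteqP; split => [w Aw|w [t _ [/= <-]]//].
  by exists (f w).
apply: countable_bigcupT_measurable => [|t]; first exact: countableP.
have [At|At] := pselect (A t).
  by rewrite (_ : [set w | A t] = setT) ?setIT//; apply/seteqP; split.
by rewrite (_ : [set w | A t] = set0) ?setI0//; apply/seteqP; split.
Qed.

Lemma measure_discrete (R : realType) (P : probability Omega R)
    (T : finType) (f : Omega -> T) (E : set Omega) :
  (forall t, measurable [set w | f w = t]) -> measurable E ->
  P E = (\sum_t P (E `&` [set w | f w = t]))%E.
Proof.
move=> mf mE; rewrite {1}(_ : E = \bigcup_t (E `&` [set w | f w = t])).
  rewrite measure_fin_bigcup; last 3 first.
  - exact: finite_finset.
  - by move=> t u _ _ [w [[_ /= <-] [_ /= <-]]].
  - by move=> t _; apply: measurableI.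
  rewrite [RHS](bigfs _ (P := predT)) ?index_enum_uniq//.
    by congr (\big[_/_]_(t \in _) _); apply/seteqP; split.
  by move=> t _; rewrite mem_index_enum.
by apply/seteqP; split => [w Ew|w [t _ []//]]; exists (f w).
Qed.

End Discrete.

Section WalkMean.
Variables (R : realType) (V : finType) (e : rel V).

(** The mean of [F] over the next [n] positions of the walk at [x]. The recursion
    is on the first step, so that harmonicity of the hitting probability is one
    unfolding of it. *)
Fixpoint walk_mean (n : nat) (x : V) (F : seq V -> R) : R :=
  if n is m.+1 then
    \sum_y step_prob R e x y * walk_mean m y (fun s => F (y :: s))
  else F [::].

Lemma eq_walk_mean n x (F G : seq V -> R) :
  (forall s, size s = n -> F s = G s) -> walk_mean n x F = walk_mean n x G.
Proof.
elim: n x F G => [|n IH] x F G FG /=; first exact: FG.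
by apply: eq_bigr => y _; congr (_ * _); apply: IH => s sn; rewrite FG//= sn.
Qed.

(** The recursion on the last step, which is what the Green function as a
    function of its endpoint needs. *)
Lemma walk_mean_rcons n x (F : seq V -> R) :
  walk_mean n.+1 x F =
  walk_mean n x (fun s => \sum_y step_prob R e (last x s) y * F (rcons s y)).
Proof.
elim: n x F => [|n IH] x F; first by [].
by apply: eq_bigr => y _; congr (_ * _); exact: (IH y (fun s => F (y :: s))).
Qed.

Lemma walk_mean_sum n x (I : finType) (c : I -> R) (F : I -> seq V -> R) :
  walk_mean n x (fun s => \sum_i c i * F i s) = \sum_i c i * walk_mean n x (F i).
Proof.
elim: n x F => [|n IH] x F //=.
under eq_bigr do rewrite IH mulr_sumr.
rewrite exchange_big; apply: eq_bigr => i _; rewrite mulr_sumr.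
by apply: eq_bigr => y _; rewrite mulrCA.
Qed.

End WalkMean.

Section Trajectory.
Variables (V : finType) (disp : measure_display) (Omega : measurableType disp).
Variable X : nat -> Omega -> V.

Definition trajectory (k n : nat) (w : Omega) : seq V :=
  [seq X i w | i <- iota k n].

Lemma trajectory_rcons k n w :
  trajectory k n.+1 w = rcons (trajectory k n w) (X (k + n) w).
Proof. by rewrite /trajectory -addn1 iotaD map_cat cats1. Qed.

Lemma mem_trajectory0 n w (b : V) :
  (b \notin trajectory 0 n.+1 w) <-> forall m, (m <= n)%N -> X m w <> b.
Proof.
split=> [/mapP bX m mn Xb|bX].
  by apply: bX; exists m => //; rewrite mem_iota.
apply/negP => /mapP[m]; rewrite mem_iota /= add0n ltnS => mn bE.
exact: bX mn (esym bE).
Qed.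

Hypothesis X_meas : forall n y, measurable [set w | X n w = y].

Lemma measurable_trajectory k n (A : set (seq V)) :
  measurable [set w | A (trajectory k n w)].
Proof.
apply: measurable_discrete => s {A}.
elim: n k s => [|n IH] k [|y s].
- by rewrite (_ : [set _ | _] = setT)//; apply/seteqP; split.
- by rewrite (_ : [set _ | _] = set0)//; apply/seteqP; split.
- by rewrite (_ : [set _ | _] = set0)//; apply/seteqP; split.
- rewrite (_ : [set _ | _] = [set w | X k w = y] `&`
    [set w | trajectory k.+1 n w = s]); first exact: measurableI.
  by apply/seteqP; split => w /= [Xk Xs]; [split|congr cons].
Qed.

Lemma measurable_prefix k (p : nat -> V) :
  measurable [set w | forall i, (i <= k)%N -> X i w = p i].
Proof.
rewrite (_ : [set _ | _] = [set w | trajectory 0 k.+1 w = mkseq p k.+1]).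
  exact: (measurable_trajectory _ _ (fun s => s = _)).
apply/seteqP; split => w /= E.
  by apply/eq_in_map => i; rewrite mem_iota => /= ik; exact: E.
by move/eq_in_map: E => E i ik; apply: E; rewrite mem_iota.
Qed.

End Trajectory.

Section Markov.
Variables (R : realType) (V : finType) (e : rel V).
Variables (disp : measure_display) (Omega : measurableType disp).
Variables (P : probability Omega R) (X : nat -> Omega -> V) (x : V).
Hypothesis X_srw : is_srw e P X x.

(** The defining property of the walk gives the probability of prescribing
    whole trajectories; splitting on the next position, which becomes part of
    the prescribed past, turns this into a formula for an arbitrary event
    about the next [n] positions. *)
Lemma markov_property n k (p : nat -> V) (F : pred (seq V)) :
  P [set w | (forall i, (i <= k)%N -> X i w = p i) /\ F (trajectory X k.+1 n w)] =
  (P [set w | forall i, (i <= k)%N -> X i w = p i] *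
   (walk_mean e n (p k) (fun s => (F s)%:R))%:E)%E.
Proof.
have [mX _ Xstep] := X_srw.
elim: n k p F => [|n IH] k p F /=.
  case: (F [::]); rewrite ?mule1 ?mule0.
    by congr (P _); apply/seteqP; split => w //= [].
  rewrite (_ : [set _ | _] = set0) ?measure0//.
  by apply/seteqP; split => w //= [].
rewrite (measure_discrete P (mX k.+1)); last first.
  apply: measurableI; first exact: measurable_prefix.
  exact: (measurable_trajectory mX k.+1 n.+1 (fun s => F s)).
have finP : P [set w | forall i, (i <= k)%N -> X i w = p i] \is a fin_num.
  exact/fin_num_measure/measurable_prefix.
rewrite -(fineK finP) -EFinM mulr_sumr -sumEFin; apply: eq_bigr => y _.
(* Extend the prescribed past by the value [y] of the next position. *)
pose p' i := if (i <= k)%N then p i else y.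
have p'S i : (i <= k.+1)%N = (i <= k)%N || (i == k.+1).
  by rewrite orbC leq_eqVlt ltnS.
have prefixS w : (forall i, (i <= k.+1)%N -> X i w = p' i) <->
    (forall i, (i <= k)%N -> X i w = p i) /\ X k.+1 w = y.
  split=> [E|[E Ey] i].
    split=> [i ik|]; first by rewrite E ?leqW// /p' ik.
    by rewrite E// /p' ltnn.
  by rewrite p'S /p'; case: (leqP i k) => [ik _|ik /eqP ->//]; exact: E.
transitivity (P [set w | (forall i, (i <= k.+1)%N -> X i w = p' i) /\
    F (y :: trajectory X k.+2 n w)]).
  congr (P _); apply/seteqP; split => w /=.
    by move=> [[E FE] Ey]; split; [exact/prefixS|rewrite -Ey].
  by move=> [/prefixS[E Ey] FE]; do 2![split => //]; rewrite /trajectory /= Ey.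
rewrite (IH k.+1 p' (fun s => F (y :: s))) Xstep.
have -> : [set w | forall i, (i <= k)%N -> X i w = p' i] =
          [set w | forall i, (i <= k)%N -> X i w = p i].
  by apply/seteqP; split => w /= E i ik; rewrite E// /p' ik.
by rewrite /p' leqnn ltnn -(fineK finP) -!EFinM mulrA.
Qed.

Lemma walk_law n (F : pred (seq V)) :
  P [set w | F (trajectory X 0 n.+1 w)] =
  (walk_mean e n x (fun s => (F (x :: s))%:R))%:E.
Proof.
have [mX X0x _] := X_srw.
have := markov_property n 0 (fun=> x) (fun s => F (x :: s)).
rewrite (_ : [set w | forall i, (i <= 0)%N -> X i w = x] = [set w | X 0%N w = x]);
  last first.
  by apply/seteqP; split => w /= E => [|i]; [exact: E|rewrite leqn0 => /eqP ->].
rewrite X0x mul1e => <-.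
have mF : measurable [set w | F (trajectory X 0 n.+1 w)].
  exact: (measurable_trajectory mX 0 n.+1 (fun s => F s)).
(* The starting point is [x] up to a null event. *)
have nx : P (~` [set w | X 0%N w = x]) = 0%E.
  by rewrite probability_setC// X0x subee.
rewrite (measureDI _ mF (mX 0%N x)) (subset_measure0 _ _ _ nx); last 3 first.
  - exact: measurableD.
  - exact: measurableC.
  - by move=> w [].
rewrite add0e; congr (P _); apply/seteqP; split => w /=.
  by move=> [FX Xx]; split=> [i|]; [rewrite leqn0 => /eqP ->|rewrite -Xx].
by move=> [E FX]; have Xx := E 0%N (leqnn _); rewrite /trajectory /= Xx.
Qed.
End Markov.

(** * The hitting probability is the voltage *)

Section Step.
Variables (R : realType) (V : finType) (e : rel V).

Lemma sum_step_prob x (f : V -> R) :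
  \sum_y step_prob R e x y * f y = (deg e x)%:R^-1 * \sum_(y | e x y) f y.
Proof.
rewrite mulr_sumr [RHS]big_mkcond; apply: eq_bigr => y _.
by rewrite /step_prob; case: ifP => //; rewrite mul0r.
Qed.

End Step.

(** Whether a finite trajectory reaches [a] strictly before any visit to [b]. *)
Fixpoint hits (V : eqType) (a b : V) (s : seq V) : bool :=
  if s is y :: s' then (y != b) && ((y == a) || hits a b s') else false.

Section Hitting.
Variables (R : realType) (V : finType) (e : rel V).
Variables (disp : measure_display) (Omega : measurableType disp).
Variables (P : V -> probability Omega R) (X : nat -> Omega -> V).
Hypothesis X_srw : forall x, is_srw e (P x) X x.
Variables (a b : V).

Lemma hitsP k n w : hits a b (trajectory X k n w) <->
  exists i, [/\ (i < n)%N, X (k + i) w = a &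
                forall j, (j <= i)%N -> X (k + j) w <> b].
Proof.
elim: n k => [|n IH] k /=; first by split=> // -[i []].
split=> [/andP[/eqP Xb /orP[/eqP Xa|/IH[i [im Xi Xj]]]]|[[|i] [im Xi Xj]]].
- by exists 0%N; rewrite addn0; split=> // j; rewrite leqn0 => /eqP ->; rewrite addn0.
- exists i.+1; rewrite addnS -addSn; split=> // -[|j] ji; rewrite ?addn0//.
  by rewrite addnS -addSn; exact: Xj.
- have := Xj 0%N (leqnn _); rewrite addn0 in Xi *; rewrite Xi eqxx andbT.
  by move/eqP.
- have /eqP := Xj 0%N isT; rewrite addn0 => -> /=; apply/orP; right.
  apply/IH; exists i; split=> //; first by rewrite addSn -addnS.
  by move=> j ji; rewrite addSn -addnS; exact: Xj.
Qed.

Lemma hits_beforeE :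
  hits_before X a b = \bigcup_n [set w | hits a b (trajectory X 0 n.+1 w)].
Proof.
apply/seteqP; split=> w.
  by move=> [n [Xn Xm]]; exists n => //; apply/(hitsP 0 n.+1); exists n.
by move=> [n _ /(hitsP 0 n.+1)[i [_ Xi Xj]]]; exists i.
Qed.

Lemma measurable_hits n : measurable [set w | hits a b (trajectory X 0 n.+1 w)].
Proof.
have [mX _ _] := X_srw a.
exact: (measurable_trajectory mX 0 n.+1 (fun s => hits a b s)).
Qed.

Lemma measurable_hits_before : measurable (hits_before X a b).
Proof. by rewrite hits_beforeE; apply: bigcupT_measurable => n; exact: measurable_hits. Qed.

Lemma hit_prob_ge0 x : 0 <= hit_prob P X a b x.
Proof. exact: fine_ge0. Qed.

Lemma hit_prob_le1 x : hit_prob P X a b x <= 1.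
Proof.
rewrite -lee_fin fineK ?fin_num_measure//; last exact: measurable_hits_before.
exact/probability_le1/measurable_hits_before.
Qed.

Lemma hit_prob_source : a != b -> hit_prob P X a b a = 1.
Proof.
move=> ab; apply/eqP; rewrite eq_le hit_prob_le1 -lee_fin fineK; last first.
  by rewrite fin_num_measure//; exact: measurable_hits_before.
have [mX Xa _] := X_srw a; rewrite -Xa le_measure ?inE//.
  exact: measurable_hits_before.
move=> w /= Xw; exists 0%N; split=> // m; rewrite leqn0 => /eqP ->.
by rewrite Xw; apply/eqP.
Qed.

Lemma hit_prob_sink : hit_prob P X a b b = 0.
Proof.
have [mX Xb _] := X_srw b.
have nb : P b (~` [set w | X 0%N w = b]) = 0%E.
  by rewrite probability_setC// Xb subee.
rewrite /hit_prob (_ : P b _ = 0%E)//.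
apply: (@subset_measure0 _ _ _ _ _ (~` [set w | X 0%N w = b])).
- exact: measurable_hits_before.
- exact/measurableC.
- by move=> w [n [_ Xn]]; exact: Xn.
- exact: nb.
Qed.

Lemma cvg_hit_prob x :
  walk_mean e n x (fun s => (hits a b (x :: s))%:R) @[n --> \oo] -->
  hit_prob P X a b x.
Proof.
rewrite (_ : (fun n => _) =
    fine \o (P x \o fun n => [set w | hits a b (trajectory X 0 n.+1 w)])); last first.
  by apply/funext => n; rewrite /comp (walk_law (X_srw x) n (hits a b)).
apply: fine_cvg; rewrite fineK ?fin_num_measure//; last first.
  exact: measurable_hits_before.
rewrite hits_beforeE; apply: nondecreasing_cvg_mu.
- exact: measurable_hits.
- by apply: bigcupT_measurable => n; exact: measurable_hits.
- move=> n m nm; apply/subsetPset => w /(hitsP 0 n.+1)[i [im Xi Xj]].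
  by apply/(hitsP 0 m.+1); exists i; split=> //; exact: leq_trans nm.
Qed.

(** First-step analysis for hitting within [n] steps, in the limit in [n]. *)
Lemma hit_prob_harmonic x : x != a -> x != b ->
  hit_prob P X a b x = \sum_y step_prob R e x y * hit_prob P X a b y.
Proof.
move=> xa xb.
have h : (fun n => \sum_y step_prob R e x y *
      walk_mean e n y (fun s => (hits a b (y :: s))%:R)) @ \oo -->
    \sum_y step_prob R e x y * hit_prob P X a b y.
  apply: (cvg_big add_continuous) => y _.
  by apply: cvgM; [exact: cvg_cst|exact: cvg_hit_prob].
apply: (cvg_unique _ _ h) => //.
have := @cvg_hit_prob x; rewrite -(cvg_shiftS _ _).
rewrite (_ : [sequence _]_n = fun n => \sum_y step_prob R e x y *
  walk_mean e n y (fun s => (hits a b (y :: s))%:R))//.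
by apply/funext => n; rewrite /= xb (negbTE xa).
Qed.

Lemma hit_prob_voltage : a != b -> unit_voltage e a b (hit_prob P X a b).
Proof.
move=> ab; split; [exact: hit_prob_source|exact: hit_prob_sink|].
move=> x xa xb; rewrite sumrB deg_mulr (hit_prob_harmonic xa xb) sum_step_prob.
have [d0|d0] := eqVneq (deg e x) 0%N; last by rewrite mulVKf ?subrr ?pnatr_eq0.
rewrite d0 mul0r big1 ?subrr// => y exy.
by have := deg_gt0 exy; rewrite d0.
Qed.

End Hitting.

(** * The probability that an edge is crossed *)

Section Crossing.
Variables (R : realType) (V : finType) (e : rel V).
Variables (a b : V).
Hypothesis ab : a != b.

(** The probability that the walk from [a] is at [x] at time [n] and has not yet
    visited [b]; summed over [n] this is the Green function of the stopped
    walk. *)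
Definition occupation (n : nat) (x : V) : R :=
  walk_mean e n a (fun s => ((last a s == x) && (b \notin a :: s))%:R).

Lemma occupation0 x : occupation 0 x = (a == x)%:R.
Proof. by rewrite /occupation /= mem_seq1 (eq_sym b) ab andbT. Qed.

Lemma occupationS n y : y != b ->
  occupation n.+1 y = \sum_x step_prob R e x y * occupation n x.
Proof.
move=> yb; rewrite /occupation -walk_mean_sum walk_mean_rcons.
apply: eq_walk_mean => s _.
rewrite (bigD1 y)//= big1 ?addr0 => [|z zy]; last first.
  by rewrite last_rcons (negbTE zy) mulr0.
rewrite [RHS](bigD1 (last a s))//= [X in _ + X]big1 ?addr0 => [|z zs]; last first.
  by rewrite eq_sym (negbTE zs) mulr0.
by rewrite last_rcons !eqxx -rcons_cons mem_rcons inE eq_sym (negbTE yb).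
Qed.

Lemma occupation_sink n : occupation n b = 0.
Proof.
have mean0 m z : walk_mean e m z (fun=> 0) = 0 :> R.
  by elim: m z => //= m IH z; rewrite big1// => y _; rewrite IH mulr0.
rewrite -[RHS](mean0 n a); apply: eq_walk_mean => s _.
by case: eqP => //= sb; rewrite -sb mem_last.
Qed.

Hypothesis e_sym : symmetric e.

(** The Green function divided by the degree has a net flow of 1 out of [a] and
    none out of the other vertices, so it is the voltage divided by its current.
    Only an upper bound is needed, and for the partial sums it follows by
    induction on [N]: they obey the monotone recursion of which the voltage is a
    fixed point. The symmetry of [e] enters here, as reversibility. *)
Lemma green_le_voltage (v : V -> R) N x :
  unit_voltage e a b v -> (forall z, 0 <= v z) ->
  0 <= \sum_(y | e a y) (v a - v y) ->
  (\sum_(y | e a y) (v a - v y)) * \sum_(n < N) occupation n x <=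
  (deg e x)%:R * v x.
Proof.
move=> [va vb vK] v0; set c := \sum_(y | e a y) (v a - v y) => c0.
elim: N x => [|N IH] y; first by rewrite big_ord0 mulr0 mulr_ge0.
have [->|yb] := eqVneq y b.
  by rewrite big1 ?mulr0 ?vb ?mulr0// => n _; exact: occupation_sink.
rewrite big_ord_recl /= occupation0.
under eq_bigr do rewrite /bump /= add1n occupationS//.
rewrite exchange_big /= mulrDr mulr_sumr.
(* The flow out of [y] is [c] at the source and zero elsewhere. *)
have flow : (deg e y)%:R * v y = c * (a == y)%:R + \sum_(z | e y z) v z.
  rewrite -deg_mulr; apply/eqP; rewrite -subr_eq -sumrB; apply/eqP.
  have [<-|ay] := eqVneq a y; first by rewrite mulr1.
  by rewrite vK ?mulr0// eq_sym.
rewrite flow lerD2l [leRHS]big_mkcond; apply: ler_sum => z _.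
rewrite -mulr_sumr mulrCA /step_prob (e_sym y z); case: ifP => [ezy|_]; last first.
  by rewrite mul0r.
by rewrite ler_pdivrMl ?ltr0n ?(deg_gt0 ezy).
Qed.

(** [crossing] as a property of the trajectory, in the form which [walk_law]
    requires. *)
Definition last_step (x y : V) (s : seq V) : bool :=
  if s is z :: s' then
    [&& b \notin belast z s', last z (belast z s') == x & last z s' == y]
  else false.

Lemma last_step_rcons x y z s t : last_step x y (z :: rcons s t) =
  [&& b \notin z :: s, last z s == x & t == y].
Proof. by rewrite /last_step belast_rcons last_rcons. Qed.

Variables (disp : measure_display) (Omega : measurableType disp).
Variables (P : probability Omega R) (X : nat -> Omega -> V).
Hypothesis X_srw : is_srw e P X a.

Definition crossing (x y : V) (n : nat) : set Omega :=
  [set w | [/\ forall m, (m <= n)%N -> X m w <> b, X n w = x & X n.+1 w = y]].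

Lemma crossingE x y n :
  crossing x y n = [set w | last_step x y (trajectory X 0 n.+2 w)].
Proof.
have stepE w : last_step x y (trajectory X 0 n.+2 w) =
    [&& b \notin trajectory X 0 n.+1 w, X n w == x & X n.+1 w == y].
  have -> : X n w = last b (trajectory X 0 n.+1 w).
    by rewrite trajectory_rcons last_rcons.
  have -> : trajectory X 0 n.+2 w = X 0%N w :: rcons (trajectory X 1 n w) (X n.+1 w).
    by rewrite -[X n.+1 w]/(X (1 + n)%N w) -trajectory_rcons.
  by rewrite last_step_rcons.
apply/seteqP; split=> w.
  by move=> [/mem_trajectory0 Xb /eqP Xx /eqP Xy]; rewrite /mkset stepE Xb Xx Xy.
rewrite /mkset stepE => /and3P[/mem_trajectory0 Xb /eqP Xx /eqP Xy].
by split.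
Qed.

Lemma measurable_crossing x y n : measurable (crossing x y n).
Proof.
have [mX _ _] := X_srw; rewrite crossingE.
exact: (measurable_trajectory mX 0 n.+2 (last_step x y)).
Qed.

Lemma probability_crossing x y n :
  P (crossing x y n) = (step_prob R e x y * occupation n x)%:E.
Proof.
rewrite crossingE (walk_law X_srw); congr (_%:E).
rewrite walk_mean_rcons /occupation.
transitivity (\sum_(i : 'I_1) step_prob R e x y * walk_mean e n a
    (fun s => ((last a s == x) && (b \notin a :: s))%:R) : R); last first.
  by rewrite big_ord1.
rewrite -(walk_mean_sum _ _ _ (fun _ => step_prob R e x y)).
apply: eq_walk_mean => s _; rewrite big_ord1 (bigD1 y)//=.
rewrite -/(last_step x y (a :: rcons s y)) last_step_rcons.
rewrite big1 ?addr0 => [|z zy]; last first.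
  by rewrite -/(last_step x y (a :: rcons s z)) last_step_rcons (negbTE zy) !andbF mulr0.
rewrite eqxx andbT andbC.
by have [<-//|] := eqVneq (last a s) x; rewrite !mulr0.
Qed.

Lemma probability_crossing_le (v : V -> R) x y : e x y ->
  unit_voltage e a b v -> (forall z, 0 <= v z) ->
  0 < \sum_(y | e a y) (v a - v y) ->
  (P (\bigcup_n crossing x y n) <= (v x / \sum_(y | e a y) (v a - v y))%:E)%E.
Proof.
move=> exy vv v0; set c := \sum_(y | e a y) (v a - v y) => c0.
have mc := measurable_crossing x y.
have sub : (P (\bigcup_n crossing x y n) <= \sum_(n <oo) P (crossing x y n))%E.
  by apply: measure_sigma_subadditive => //; exact: bigcupT_measurable.
apply: (le_trans sub).
apply: lime_le; first exact: is_cvg_nneseries.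
apply: nearW => N; rewrite big_mkord.
under eq_bigr do rewrite probability_crossing.
rewrite sumEFin lee_fin -mulr_sumr /step_prob exy ler_pdivlMr// mulrC.
rewrite mulrCA ler_pdivrMl ?ltr0n ?(deg_gt0 exy)//.
exact: green_le_voltage (ltW c0).
Qed.

End Crossing.

(** * The random network *)

Section Path.
Variables (R : realType) (V : finType) (e : rel V).
Variables (disp : measure_display) (Omega : measurableType disp).
Variables (P : probability Omega R) (X : nat -> Omega -> V).
Variables (a b : V).
Hypotheses (ab : a != b) (e_sym : symmetric e) (X_srw : is_srw e P X a).

Lemma walk_path_sym w : symmetric (walk_path e X b w).
Proof.
move=> x y; rewrite /walk_path e_sym; congr (_ && _); apply/asboolP/asboolP.
  by move=> [n [Xb H]]; exists n; split=> //; case: H => H; [right|left].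
by move=> [n [Xb H]]; exists n; split=> //; case: H => H; [right|left].
Qed.

Lemma walk_path_crossing x y : e x y -> [set w | walk_path e X b w x y] =
  \bigcup_n crossing b X x y n `|` \bigcup_n crossing b X y x n.
Proof.
move=> exy; apply/seteqP; split=> w; rewrite /mkset /walk_path exy /=.
  by move=> /asboolP[n [Xb [[Xx Xy]|[Xy Xx]]]]; [left|right]; exists n.
by move=> [[n _ [Xb Xx Xy]]|[n _ [Xb Xy Xx]]]; apply/asboolP; exists n; split;
  [|left| |right].
Qed.

Lemma measurable_walk_path x y : measurable [set w | walk_path e X b w x y].
Proof.
have [exy|exy] := boolP (e x y); last first.
  rewrite (_ : [set _ | _] = set0)//.
  by apply/seteqP; split=> // w; rewrite /mkset /walk_path (negbTE exy).
rewrite walk_path_crossing//.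
by apply: measurableU; apply: bigcupT_measurable => n;
  exact: (measurable_crossing b X_srw).
Qed.

(** There are finitely many relations on [V], so every function of PATH is
    measurable, in particular the effective resistance. *)
Lemma measurable_walk_path_fun d (T : measurableType d) (F : rel V -> T) :
  measurable_fun setT (fun w => F (walk_path e X b w)).
Proof.
pose B w : {ffun V * V -> bool} := [ffun p => walk_path e X b w p.1 p.2].
have -> : (fun w => F (walk_path e X b w)) =
    (fun w => F (fun x y => B w (x, y))).
  apply/funext => w; congr F; apply/funext => x; apply/funext => y.
  by rewrite ffunE.
move=> _ Y _; rewrite setTI.
apply: (measurable_discrete (f := B)
  (fun t : {ffun V * V -> bool} => Y (F (fun x y => t (x, y))))) => t.
rewrite (_ : [set _ | _] =
    \bigcap_(p in [set: V * V]) [set w | walk_path e X b w p.1 p.2 = t p]).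
  apply: fin_bigcap_measurable => [|-[x y] _ /=]; first exact: finite_finset.
  have [_|_] := boolP (t (x, y)); first exact: measurable_walk_path.
  rewrite (_ : [set _ | _] = ~` [set w | walk_path e X b w x y]).
    exact/measurableC/measurable_walk_path.
  by apply/seteqP; split=> w /=; case: (walk_path _ _ _ _ _ _).
apply/seteqP; split=> w /=; first by move=> <- p _ /=; rewrite ffunE.
by move=> E; apply/ffunP => p; rewrite ffunE; exact: E.
Qed.

Lemma energy_walk_path (f : V -> R) w : (energy (walk_path e X b w) f f)%:E =
  (\sum_(p : V * V | e p.1 p.2) (2^-1 * (f p.1 - f p.2) ^+ 2)%:E *
     (\1_[set w | walk_path e X b w p.1 p.2] w)%:E)%E.
Proof.
under eq_bigr do rewrite -EFinM.
rewrite sumEFin /energy; congr (_%:E).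
rewrite pair_big_dep /= mulr_sumr big_mkcond [RHS]big_mkcond; apply: eq_bigr => -[x y] _ /=.
rewrite indicE.
have -> : (w \in [set w | walk_path e X b w x y]) = walk_path e X b w x y.
  by apply/idP/idP; rewrite inE.
case: (boolP (walk_path e X b w x y)) => [/andP[-> _]|_].
  by rewrite mulr1 expr2.
by rewrite mulr0; case: ifP.
Qed.

Lemma expectation_energy_walk_path (f : V -> R) :
  (\int[P]_w (energy (walk_path e X b w) f f)%:E =
   \sum_(p : V * V | e p.1 p.2) (2^-1 * (f p.1 - f p.2) ^+ 2)%:E *
     P [set w | walk_path e X b w p.1 p.2])%E.
Proof.
under eq_integral do rewrite energy_walk_path.
have c0 (p : V * V) : 0 <= 2^-1 * (f p.1 - f p.2) ^+ 2.
  by rewrite mulr_ge0 ?invr_ge0 ?sqr_ge0.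
under eq_integral do rewrite -big_filter.
rewrite ge0_integral_sum//.
- rewrite -[RHS]big_filter; apply: eq_bigr => p _.
  rewrite ge0_integralZl_EFin//.
  + by rewrite integral_indic// ?setIT//; exact: measurable_walk_path.
  + apply/measurable_EFinP; apply: measurable_indic.
    exact: measurable_walk_path.
- move=> p; apply: measurable_funeM; apply/measurable_EFinP.
  by apply: measurable_indic; exact: measurable_walk_path.
- by move=> p w _; rewrite mule_ge0 ?lee_fin.
Qed.

Lemma probability_walk_path_le (v : V -> R) x y : e x y ->
  unit_voltage e a b v -> (forall z, 0 <= v z) ->
  0 < \sum_(y | e a y) (v a - v y) ->
  (P [set w | walk_path e X b w x y] <=
   ((v x + v y) / \sum_(y | e a y) (v a - v y))%:E)%E.
Proof.
move=> exy vv v0 c0; rewrite walk_path_crossing// mulrDl EFinD.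
have mU x' y' : measurable (\bigcup_n crossing b X x' y' n).
  by apply: bigcupT_measurable => n; exact: (measurable_crossing b X_srw).
have sub := measureU2 P (mU x y) (mU y x).
by apply: (le_trans sub); apply: leeD; apply: (probability_crossing_le ab e_sym X_srw);
  rewrite // e_sym.
Qed.

(** Jensen's inequality for [1 / x] in its tangent-line form: integrate
    [eff_resistance_ge_affine] with [t = 1 / K], the value of [t] that maximizes
    [2 t l - t^2 K l]. This form also allows the resistance to be infinite. *)
Lemma expected_resistance_ge (K : R) (g : V -> R) : 0 < K ->
  (\int[P]_w (energy (walk_path e X b w) g g)%:E <= (K * (g a - g b))%:E)%E ->
  (((g a - g b) / K)%:E <=
   \int[P]_w eff_resistance R (walk_path e X b w) a b)%E.
Proof.
move=> K0 EQ; set l := g a - g b in EQ *.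
set Res := fun w => eff_resistance R (walk_path e X b w) a b.
have Res0 w : (0 <= Res w)%E.
  rewrite /Res /eff_resistance inver; case: ifP => // _.
  by rewrite lee_fin invr_ge0 eff_conductance_ge0//; exact: walk_path_sym.
have mRes : measurable_fun setT Res.
  exact: (measurable_walk_path_fun (fun H => eff_resistance R H a b)).
have mE : measurable_fun setT (fun w => (energy (walk_path e X b w) g g)%:E).
  exact: (measurable_walk_path_fun (fun H => (energy H g g)%:E)).
have E0 w : (0 <= (energy (walk_path e X b w) g g)%:E)%E.
  by rewrite lee_fin energy_sqr_ge0.
have mQ : measurable_fun setT (fun w => (K^-1 ^+ 2)%:E *
  (energy (walk_path e X b w) g g)%:E)%E by exact: measurable_funeM.
have [l0|l0] := leP l 0.
  apply: (@le_trans _ _ 0%E); last by apply: integral_ge0 => w _; exact: Res0.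
  by rewrite lee_fin mulr_le0_ge0// invr_ge0 ltW.
have : (\int[P]_w (cst (2 * K^-1 * l)%:E w) <= \int[P]_w (Res w +
    (K^-1 ^+ 2)%:E * (energy (walk_path e X b w) g g)%:E))%E.
  apply: ge0_le_integral => //.
  - by move=> w _; rewrite lee_fin !mulr_ge0 ?invr_ge0// ltW.
  - exact: emeasurable_funD.
  - move=> w _; rewrite -EFinM.
    exact: (eff_resistance_ge_affine (@walk_path_sym w)).
rewrite integral_cst//= probability_setT mule1 ge0_integralD//; last first.
  by move=> w _; rewrite mule_ge0// lee_fin sqr_ge0.
rewrite ge0_integralZl_EFin ?sqr_ge0// => le1.
have := le_trans le1 (leeD (lexx _) (lee_wpmul2l _ EQ)).
rewrite lee_fin sqr_ge0 => /(_ isT).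
rewrite -EFinM -leeBlDr// -EFinB.
congr (_ <= _)%E; congr (_%:E); field.
exact: lt0r_neq0.
Qed.

End Path.

Theorem corollary11 (R : realType) (V : finType) (e : rel V)
    (e_sym : symmetric e) (e_irr : irreflexive e) (e_conn : connected_graph e)
    (X0 Y0 : V) (X0Y0 : X0 != Y0)
    (disp : measure_display) (Omega : measurableType disp)
    (P : V -> probability Omega R) (X : nat -> Omega -> V)
    (X_srw : forall x, is_srw e (P x) X x) :
  let v := hit_prob P X X0 Y0 in
  let s : R := \big[Order.max/0]_(y | e y Y0) v y in
  let d : nat := (\max_(x | x != Y0) deg e x)%N in
  ((ln s^-1 / (12 * ln d%:R))%:E <=
     \int[P X0]_w eff_resistance R (walk_path e X Y0 w) X0 Y0)%E.
Proof.
cbv zeta; set v := hit_prob P X X0 Y0.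
set s := \big[Order.max/0]_(y | e y Y0) v y.
set d := (\max_(x | x != Y0) deg e x)%N.
have res_ge0 : (0 <= \int[P X0]_w eff_resistance R (walk_path e X Y0 w) X0 Y0)%E.
  apply: integral_ge0 => w _; rewrite /eff_resistance inver; case: ifP => // _.
  by rewrite lee_fin invr_ge0 eff_conductance_ge0//; exact: walk_path_sym.
have [L0|L0] := leP (ln s^-1) 0.
  apply: le_trans res_ge0; rewrite lee_fin mulr_le0_ge0// invr_ge0 mulr_ge0//.
  have [->|d0] := posnP d; first by rewrite ln0.
  by rewrite ln_ge0// ler1n.
(* For [d <= 1] the denominator is 0, and so is the quotient. *)
have [d2|d2] := leqP 2 d; last first.
  rewrite (_ : ln d%:R = 0) ?mulr0 ?invr0 ?mulr0//.
  by case: (d) d2 => [|[|]]// _; rewrite ?ln1 ?ln0.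
have s0 : 0 < s.
  rewrite lt_neqAle bigmax_ge_id andbT; apply/negP => /eqP sE.
  by move: L0; rewrite -sE invr0 ln0 ?ltxx.
have s1 : s < 1.
  by rewrite ltNge; apply/negP => s1; move: L0; rewrite ltNge ln_le0// invf_le1.
have vv : unit_voltage e X0 Y0 v by exact: hit_prob_voltage.
have [v1 v0 _] := vv.
have v01 z : 0 <= v z <= 1.
  by rewrite hit_prob_ge0 (hit_prob_le1 X_srw).
have v_ge0 z : 0 <= v z by case/andP: (v01 z).
set C := \sum_(y | e X0 y) (v X0 - v y).
have C0 : 0 < C by exact: voltage_current_gt0 vv.
pose phi x : R := ln (Num.max (v x) s).
have phi_drop : phi X0 - phi Y0 = ln s^-1.
  rewrite /phi v1 v0 (max_idPl (ltW s1)) (max_idPr (ltW s0)) ln1 sub0r.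
  by rewrite lnV ?posrE.
have ln_d0 : 0 < ln d%:R :> R by rewrite ln_gt0// ltr1n.
have K0 : 0 < 12 * ln d%:R :> R by rewrite mulr_gt0.
rewrite -phi_drop; apply: (expected_resistance_ge X0Y0 e_sym (X_srw X0) K0).
rewrite (expectation_energy_walk_path _ (X_srw X0)).
(* By the definition of [s] the cap makes [phi] constant around [Y0]. *)
have phiY y : e y Y0 -> phi y = phi Y0.
  move=> ey; rewrite /phi v0 (max_idPr (ltW s0)) (max_idPr _)//.
  exact: le_bigmax_cond.
have degd y : y != Y0 -> (deg e y)%:R <= d%:R :> R.
  by move=> yY; rewrite ler_nat; exact: leq_bigmax_cond.
have edge x y : e x y ->
    (v x + v y) * (phi x - phi y) ^+ 2 <=
    12 * ln d%:R * ((v x - v y) * (phi x - phi y)).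
  move=> exy; have eyx : e y x by rewrite e_sym.
  have [xY|xY] := eqVneq x Y0.
    by rewrite xY (phiY y) -?xY// subrr expr2 !mulr0.
  have [yY|yY] := eqVneq y Y0.
    by rewrite yY (phiY x) -?yY// subrr expr2 !mulr0.
  apply: ln_max_slope => //; first by rewrite ler_nat.
    apply: le_trans (voltage_harnack e_sym vv v01 exy yY) _.
    by rewrite ler_wpM2r// degd.
  apply: le_trans (voltage_harnack e_sym vv v01 eyx xY) _.
  by rewrite ler_wpM2r// degd.
apply: (@le_trans _ _ (\sum_(p : V * V | e p.1 p.2)
    (12 * ln d%:R / C * (2^-1 * ((v p.1 - v p.2) * (phi p.1 - phi p.2))))%:E)).
  apply: lee_sum => -[x y] /= exy.
  apply: le_trans (lee_wpmul2l _ (probability_walk_path_le X0Y0 e_sym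
    (X_srw X0) exy vv v_ge0 C0)) _.
    by rewrite lee_fin mulr_ge0 ?invr_ge0 ?sqr_ge0.
  rewrite -EFinM lee_fin -/C.
  rewrite [leLHS](_ : _ = (2 * C)^-1 * ((v x + v y) * (phi x - phi y) ^+ 2)).
    rewrite [leRHS](_ : _ = (2 * C)^-1 *
      (12 * ln d%:R * ((v x - v y) * (phi x - phi y)))).
      by rewrite ler_pM2l ?edge// invr_gt0 mulr_gt0.
    by field; exact: lt0r_neq0.
  by field; exact: lt0r_neq0.
rewrite sumEFin lee_fin -!mulr_sumr -(pair_big_dep xpredT e
  (fun x y => (v x - v y) * (phi x - phi y))) /=.
rewrite -/(energy e v phi) (voltage_energy e_sym phi X0Y0 vv) -/C.
by rewrite mulrA divfK// lt0r_neq0.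
Qed.
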